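(* Against an oblivious adversary in the ASYNC$_{IC}$ model (arbitrary wait times $\mathcal{W}\ge 0$, zero computation delay $\mathcal{C}=0$), if the algorithm knows the ratio $\alpha$ of the speeds of the two robots, then it is possible to gather the two robots: there is a randomized algorithm such that, for every choice of wait times by the adversary, the robots gather with positive probability.
   Context: Two robots are anonymous, oblivious (no memory of past cycles), silent (no communication) points in the Euclidean plane with no common coordinate system, each having access to random bits; each robot moves at its own constant speed, and $\alpha>0$ denotes the ratio of their speeds (a robot cannot tell whether it is the faster or slower one). Each robot repeatedly executes a cycle in which it stays still for a while, then moves: the look instant (when it obtains a snapshot of the other robot's current position, which may be in motion) splits the stationary period into a wait time $\mathcal{W}$ (before the look) and a computation delay $\mathcal{C}$ (after the look). It then moves to a destination computed from the snapshot and its random bits, reaching it in the same cycle (rigid movement). A robot that looks and finds the other robot at its own position decides it has gathered and never moves again; gathering means both robots are at the same point. The scheduler is an adversary choosing the wait times and computation delays of every cycle of each robot; an oblivious adversary knows the algorithm but not the outcomes of random bits, so it fixes all these sequences before the execution. ASYNC$_{IC}$ is the asynchronous model with all computation delays equal to $0$. *)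

(* Defs.v *)
From HB Require Import structures.
From mathcomp Require Import all_boot all_order all_algebra.
From mathcomp Require Import all_classical all_reals all_analysis.

Set Implicit Arguments.
Unset Strict Implicit.
Unset Printing Implicit Defensive.

Import Order.TTheory GRing.Theory Num.Theory.
Local Open Scope classical_set_scope.
Local Open Scope ring_scope.

(* Euclidean norm (the library's norm on 'rV is the max norm). *)
Definition enorm (R : realType) (x : 'rV[R]_2) : R :=
  Num.sqrt (x ord0 ord0 ^+ 2 + x ord0 ord_max ^+ 2).

(* A local coordinate system of a robot, centred at the robot: a linear
   similarity (rotation and/or reflection composed with a positive scaling).
   Local coordinates u correspond to the global displacement [f u]. *)
Definition is_similarity (R : realType) (f : 'rV[R]_2 -> 'rV[R]_2) : Prop :=
  (forall (a : R) (x y : 'rV[R]_2), f (a *: x + y) = a *: f x + f y) /\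
  exists s : R, 0 < s /\ forall x, enorm (f x) = s * enorm x.

(* An oblivious randomized algorithm: from the snapshot (position of the other
   robot, in the robot's own local frame centred at itself) and a fresh stream
   of random bits, compute a destination (in the same local frame). *)
Definition algorithm (R : realType) := 'rV[R]_2 -> (nat -> bool) -> 'rV[R]_2.

(* Randomness: a single uniform point w of [0,1] (Lebesgue measure); its binary
   digits are i.i.d. fair bits.  Digit n of w: *)
Definition bit_of (R : realType) (w : R) (n : nat) : bool :=
  odd `|Num.floor (w * 2 ^+ n.+1)|%N.

(* Random bit number j available to robot r in its k-th cycle: distinct
   (r,k,j) use distinct binary digits of w, hence independent fair bits. *)
Definition coins (R : realType) (w : R) (r : bool) (k j : nat) : bool :=
  bit_of w (pickle (r, k, j)).

Definition halts (R : realType) (pos : bool -> R -> 'rV[R]_2)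
  (W S : bool -> nat -> R) (r : bool) (k : nat) : Prop :=
  pos (~~ r) (S r k + W r k) = pos r (S r k + W r k).

(* An ASYNC_IC execution (computation delay 0).
   A : algorithm, v r : speed of robot r, F r : local frame of robot r,
   W r k : wait time of robot r in cycle k (chosen by the adversary),
   c r k : random bit stream of robot r in cycle k, p0 : initial positions,
   pos r t : position of robot r at time t, S r k : start time of cycle k.
   In cycle k, robot r stays still at P := pos r (S r k) during
   [S r k, L] with L := S r k + W r k, looks at time L; if it sees the other
   robot at its own position it stops forever; otherwise it moves in a
   straight line at speed v r to the computed destination D, which it reaches
   at time S r k.+1 = L + |D - P| / v r, when the next cycle starts. *)
Definition execution (R : realType) (A : algorithm R) (v : bool -> R)
  (F : bool -> 'rV[R]_2 -> 'rV[R]_2) (W : bool -> nat -> R)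
  (c : bool -> nat -> nat -> bool) (p0 : bool -> 'rV[R]_2)
  (pos : bool -> R -> 'rV[R]_2) (S : bool -> nat -> R) : Prop :=
  forall r : bool,
    S r 0%N = 0 /\ pos r 0 = p0 r /\
    forall k : nat, (forall j, (j < k)%N -> ~ halts pos W S r j) ->
      let P := pos r (S r k) in
      let L := S r k + W r k in
      (forall t, S r k <= t <= L -> pos r t = P) /\
      (halts pos W S r k -> forall t, L <= t -> pos r t = P) /\
      (~ halts pos W S r k ->
         exists u, F r u = pos (~~ r) L - P /\
           let D := P + F r (A u (c r k)) in
           S r k.+1 = L + enorm (D - P) / v r /\
           forall t, L <= t <= S r k.+1 ->
             pos r t = P + ((t - L) * v r / enorm (D - P)) *: (D - P)).

Definition gathered (R : realType) (pos : bool -> R -> 'rV[R]_2) : Prop :=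
  exists t : R, 0 <= t /\ forall t', t <= t' -> pos true t' = pos false t'.

(* Main.v *)
(* Each robot moves by a random fraction of the observed vector to the other
   robot, drawn from the rationals together with the two fractions a/(1+a) and
   1/(1+a) of a head-on meeting.  Since the waits are fixed in advance, it is
   enough to find, for each choice of waits, finitely many fractions that
   force gathering: finitely many coins then decide, on a dyadic interval.
   Let r be the robot that looks first and s the other one.
   - If r can reach s within the first two waits of s, then s stays and r goes.
   - Otherwise, if the third wait W s 2 is 0, then s stays once and next moves
     to the point where it crosses r.  As it looks again at that very instant,
     it sees r on itself and stops forever; r joins it later.
   - If W s 2 > 0, then W r 1 < W s 1 + W s 2 or W s 1 < W r 1 + W r 2.  The
     robots move to arrive almost at the same point at almost the same time
     (rationals are dense), and then the robot on the smaller side has time to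
     reach the other one while the latter waits, stays and waits again. *)
Require Import Defs.
From HB Require Import structures.
From mathcomp Require Import all_boot all_order all_algebra.
From mathcomp Require Import all_classical all_reals all_analysis.
From mathcomp Require Import zify ring lra.

Set Implicit Arguments.
Unset Strict Implicit.
Unset Printing Implicit Defensive.

Import Order.TTheory GRing.Theory Num.Theory.
Local Open Scope classical_set_scope.
Local Open Scope ring_scope.

(** * Euclidean norm and local frames *)

Lemma line_addr (R : realType) (p w : 'rV[R]_2) (a b : R) :
  p + a *: w + b *: w = p + (a + b) *: w.
Proof. by rewrite scalerDl addrA. Qed.

Lemma enormZ (R : realType) (a : R) (x : 'rV[R]_2) :
  enorm (a *: x) = `|a| * enorm x.
Proof.
rewrite /enorm !mxE !exprMn -mulrDr sqrtrM ?sqr_ge0 //.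
by rewrite sqrtr_sqr.
Qed.

Lemma enorm_gt0 (R : realType) (x : 'rV[R]_2) : x != 0 -> 0 < enorm x.
Proof.
move=> x0; rewrite sqrtr_gt0 lt_neqAle addr_ge0 ?sqr_ge0 // andbT eq_sym.
apply: contra x0; rewrite paddr_eq0 ?sqr_ge0 // !sqrf_eq0 => /andP[/eqP x1 /eqP x2].
apply/eqP/rowP => i; rewrite mxE.
case: i => [[|[|//]]] h.
- by rewrite -[RHS]x1; congr (x _ _); apply: val_inj.
- by rewrite -[RHS]x2; congr (x _ _); apply: val_inj.
Qed.

Lemma similarityZ (R : realType) (f : 'rV[R]_2 -> 'rV[R]_2) (a : R) x :
  is_similarity f -> f (a *: x) = a *: f x.
Proof.
move=> [fl _].
have f0 : f 0 = 0 by have := fl (-1) 0 0; rewrite scaler0 addr0 scaleN1r addNr.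
by rewrite -[a *: x]addr0 fl f0 addr0.
Qed.

(** * Prescribing finitely many coins *)

(** These [w] fill a dyadic interval of length [2 ^- N]; the digits of [m] are the first [N] values
    of [b], most significant first, and each further digit halves the interval. *)
Lemma prescribed_bits (R : realType) (b : nat -> bool) (N : nat) :
  exists2 m : nat, (m < 2 ^ N)%N &
    forall w : R, m%:R <= w * 2 ^+ N < m.+1%:R ->
      forall n, (n < N)%N -> bit_of w n = b n.
Proof.
elim: N => [|N [m mN IH]]; first by exists 0%N.
exists (m.*2 + b N)%N => [|w hw n].
  by rewrite expnS mul2n; case: (b N); lia.
rewrite ltnS leq_eqVlt => /predU1P[->|]; last first.
  apply: IH; move: hw; rewrite exprS mulrCA -addn1 -muln2 !natrD natrM.
  have : 0 <= (b N)%:R :> R /\ (b N)%:R <= 1 :> R by case: (b N); rewrite ?ler01.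
  by rewrite -(addn1 m) natrD; lra.
rewrite /bit_of; have -> : Num.floor (w * 2 ^+ N.+1) = (m.*2 + b N)%N.
  by apply: floor_def; rewrite intrD -!pmulrn -natrD addn1; exact: hw.
by rewrite oddD odd_double oddb.
Qed.

(** Finitely many fair bits thus yield any given natural number with positive probability. *)
Definition first_tail (c : nat -> bool) : nat :=
  xget 0%N [set n | ~~ c n /\ forall j, (j < n)%N -> c j].

Lemma first_tailE (c : nat -> bool) (n : nat) :
  (forall j, (j <= n)%N -> c j = (j < n)%N) -> first_tail c = n.
Proof.
move=> cE; apply: xget_unique => [|m [cm jm]].
  by split => [|j jn]; rewrite cE ?ltnn// ltnW.
case: (ltngtP m n) => // [mn|nm]; last by have := jm _ nm; rewrite cE ?ltnn.
by move: cm; rewrite cE ?mn ?(ltnW mn).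
Qed.

Lemma prescribed_coins (R : realType) (e : bool -> nat -> nat) (K : nat) :
  exists E : set R,
    measurable E /\ E `<=` `[0, 1] /\ (0 < lebesgue_measure E)%E /\
    forall w, E w -> forall r k, (k < K)%N -> first_tail (coins w r k) = e r k.
Proof.
pose b n := if unpickle n is Some (r, k, j) then (j < e r k)%N else false.
(* [N] exceeds the codes of all bits up to the first tail, the one at index [e r k] included. *)
pose N := (\max_(r : bool) \max_(k < K) \max_(j < (e r k).+1)
  (pickle (r, k : nat, j : nat)).+1)%N.
have [m mN bE] := prescribed_bits R b N.
have p0 : 0 < 2 ^+ N :> R by rewrite exprn_gt0.
exists `[m%:R / 2 ^+ N, m.+1%:R / 2 ^+ N[%classic; split=> //; split; [|split].
- move=> w; rewrite /= !in_itv /= ler_pdivrMr // ltr_pdivlMr // => /andP[w0 w1].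
  rewrite -(pmulr_lge0 _ p0) (le_trans _ w0) //=.
  rewrite -(ler_pM2r p0) (le_trans (ltW w1)) // mul1r -natrX ler_nat.
  exact: mN.
- rewrite lebesgue_measure_itv /= lte_fin ltr_pM2r ?invr_gt0 // ltr_nat leqnn.
  by rewrite -EFinB lte_fin subr_gt0 ltr_pM2r ?invr_gt0 // ltr_nat.
- move=> w; rewrite /= in_itv /= ler_pdivrMr // ltr_pdivlMr // => hw r k kK.
  apply: first_tailE => j; rewrite -ltnS => jn; rewrite /coins bE //; last first.
    apply: leq_trans (leq_bigmax r).
    apply: leq_trans (leq_bigmax (Ordinal kK)) => /=.
    exact: (leq_bigmax (Ordinal jn)).
  by rewrite /b pickleK.
Qed.

(** * Motion with prescribed fractions *)

Definition alive (R : realType) (pos : bool -> R -> 'rV[R]_2)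
  (W S : bool -> nat -> R) (r : bool) (k : nat) : Prop :=
  forall j, (j < k)%N -> ~ halts pos W S r j.

(* Only the cycles [k < K] are prescribed, since they must depend on finitely
   many coins. *)
Record follows (R : realType) (v : bool -> R) (W : bool -> nat -> R)
    (lam : bool -> nat -> R) (K : nat) (p0 : bool -> 'rV[R]_2)
    (pos : bool -> R -> 'rV[R]_2) (S : bool -> nat -> R) : Prop := Follows {
  follows_start : forall r, S r 0%N = 0;
  follows_init : forall r, pos r 0 = p0 r;
  follows_wait : forall r k, alive pos W S r k ->
    forall t, S r k <= t <= S r k + W r k -> pos r t = pos r (S r k);
  follows_halt : forall r k, alive pos W S r k -> halts pos W S r k ->
    forall t, S r k + W r k <= t -> pos r t = pos r (S r k);
  follows_move : forall r k, (k < K)%N -> alive pos W S r k ->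
    ~ halts pos W S r k ->
    let P := pos r (S r k) in
    let L := S r k + W r k in
    let z := lam r k *: (pos (~~ r) L - P) in
    S r k.+1 = L + enorm z / v r /\
    forall t, L <= t <= S r k.+1 -> pos r t = P + ((t - L) * v r / enorm z) *: z
}.

Section Kinematics.
Variables (R : realType) (v : bool -> R) (W : bool -> nat -> R).
Variables (lam : bool -> nat -> R) (K : nat) (p0 : bool -> 'rV[R]_2).
Variables (pos : bool -> R -> 'rV[R]_2) (S : bool -> nat -> R).
Hypothesis v_gt0 : forall r, 0 < v r.
Hypothesis W_ge0 : forall r k, 0 <= W r k.
Hypothesis posS : follows v W lam K p0 pos S.

Local Notation look r k := (S r k + W r k).
Local Notation alive := (alive pos W S).
Local Notation halts := (halts pos W S).

Lemma alive0 r : alive r 0%N. Proof. by []. Qed.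
Arguments alive0 : clear implicits.

Lemma aliveS r k : alive r k -> ~ halts r k -> alive r k.+1.
Proof.
by move=> a h j; rewrite ltnS leq_eqVlt => /predU1P[->//|]; apply: a.
Qed.

Lemma pos_wait r k X : alive r k -> pos r (S r k) = X ->
  forall t, S r k <= t <= look r k -> pos r t = X.
Proof. by move=> rk <- t; apply: (follows_wait posS). Qed.

Lemma haltsE r k : alive r k ->
  halts r k <-> pos (~~ r) (look r k) = pos r (S r k).
Proof.
move=> rk; rewrite /Defs.halts (follows_wait posS rk (t := look r k)) //.
by rewrite lerDl W_ge0 lexx.
Qed.

Lemma pos_halt r k X : alive r k -> halts r k -> pos r (S r k) = X ->
  forall t, S r k <= t -> pos r t = X.
Proof.
move=> rk hk <- t Skt; have [tL|/ltW Lt] := leP t (look r k).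
  by apply: (follows_wait posS) => //; rewrite Skt.
exact: (follows_halt posS).
Qed.

Lemma move_from r k (P z : 'rV[R]_2) (l : R) :
  (k < K)%N -> alive r k -> pos r (S r k) = P ->
  pos (~~ r) (look r k) = P + z -> z != 0 -> lam r k = l -> 0 <= l ->
  [/\ alive r k.+1, S r k.+1 = look r k + l * enorm z / v r,
      pos r (S r k.+1) = P + l *: z &
      forall t, look r k <= t <= S r k.+1 ->
        pos r t = P + ((t - look r k) * v r / enorm z) *: z].
Proof.
move=> kK rk rP oQ z0 lE l0.
have nh : ~ halts r k.
  move=> /(haltsE rk).1; rewrite oQ rP -[RHS]addr0 => /addrI z00.
  by rewrite z00 eqxx in z0.
have := follows_move posS kK rk nh; rewrite /= rP oQ lE [P + z]addrC addrK enormZ.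
rewrite ger0_norm // => -[SE posE].
have ez := enorm_gt0 z0.
have posE' t : look r k <= t <= S r k.+1 ->
    pos r t = P + ((t - look r k) * v r / enorm z) *: z.
  move=> tE; rewrite posE // scalerA; congr (_ + _ *: _).
  (* For [l = 0] the quotient by the zero length does not simplify, but the move is a single
     instant. *)
  have [l00|lN0] := eqVneq l 0; last first.
    by field; rewrite lN0 gt_eqF.
  move: tE; rewrite SE l00 !mul0r addr0 mulr0 => tE.
  have -> : t = look r k by lra.
  by rewrite subrr !mul0r.
split=> //; first exact: aliveS.
rewrite posE' SE ?lexx ?andbT ?lerDl ?divr_ge0 ?mulr_ge0 //;
  rewrite ?(ltW ez) ?(ltW (v_gt0 r)) //.
by congr (_ + _ *: _); field; rewrite !gt_eqF.
Qed.

(* The left disjunct is for a robot that has halted, possibly before time [t]. *)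
Definition parked (o : bool) (X : 'rV[R]_2) (t L : R) : Prop :=
  (forall t', t <= t' -> pos o t' = X) \/
  exists j, [/\ alive o j, L <= look o j &
    forall t', t <= t' <= look o j -> pos o t' = X].

Lemma parked_pos o X t L t' : parked o X t L -> t <= t' <= L -> pos o t' = X.
Proof.
by move=> [p|[j [_ Lj p]]] /andP[tt' t'L]; apply: p; rewrite ?tt' ?(le_trans t'L).
Qed.

Lemma parkedW o X t1 L1 t2 L2 :
  parked o X t1 L1 -> t1 <= t2 -> L2 <= L1 -> parked o X t2 L2.
Proof.
move=> p t12 L21; case: p => [p|[j [oj Lj p]]].
  by left=> t t2t; apply: p; apply: le_trans t2t.
right; exists j; split=> // [|t /andP[t2t tj]]; first exact: le_trans Lj.
by apply: p; rewrite (le_trans t12).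
Qed.

(** A move by the fraction 0 takes no time, so two consecutive waits merge into one; a robot that
    halts at the first look stays forever. *)
Lemma parked_stay o j X L : (j < K)%N -> alive o j -> pos o (S o j) = X ->
  lam o j = 0 -> L <= look o j + W o j.+1 -> parked o X (S o j) L.
Proof.
move=> jK oj oX l0 Lj.
have [hj|nh] := EM (halts o j); first by left; exact: pos_halt hj oX.
have [SE _] := follows_move posS jK oj nh.
rewrite l0 scale0r -(scale0r 0) enormZ normr0 !mul0r addr0 in SE.
have oj1 := aliveS oj nh.
right; exists j.+1; rewrite SE; split=> // t /andP[jt tj].
have [tL|/ltW Lt] := leP t (look o j); first by apply: (pos_wait oj oX); rewrite jt.
apply: (pos_wait oj1); rewrite SE ?Lt //.
by apply: (pos_wait oj oX); rewrite lerDl W_ge0 lexx.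
Qed.

(** Both robots stand at [X]: whichever looks first sees the other one there and stops for good, and
    the other one then does so at its own look. *)
Lemma gathered_arrive c i X L : alive c i -> pos c (S c i) = X -> 0 <= S c i ->
  parked (~~ c) X (S c i) L -> S c i <= L -> gathered pos.
Proof.
move=> ci cX S0 park SL.
have St : S c i <= look c i by rewrite lerDl.
suff [cF oF] : (forall t, S c i <= t -> pos c t = X) /\
               (forall t, S c i <= t -> pos (~~ c) t = X).
  exists (S c i); split=> // t /[dup] /cF + /oF.
  by case: (c) => -> ->.
have cFif : pos (~~ c) (look c i) = X -> forall t, S c i <= t -> pos c t = X.
  by move=> oX; apply: (pos_halt ci _ cX); apply/(haltsE ci).2; rewrite oX cX.
case: park => [oF|[j [oj Lj oW]]].
  by split=> //; apply/cFif/oF.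
have oFif : pos c (look (~~ c) j) = X ->
    forall t, S c i <= t -> pos (~~ c) t = X.
  move=> cXj t it.
  have hj : halts (~~ c) j.
    by rewrite /Defs.halts negbK cXj oW // lexx (le_trans SL).
  have [tj|/ltW jt] := leP t (look (~~ c) j); first by rewrite oW // it.
  (* Cycle [j] may have started before [S c i], so the halting position is identified with [X] at
     the look. *)
  rewrite (follows_halt posS oj hj jt) -(follows_halt posS oj hj (lexx _)).
  by rewrite oW // lexx (le_trans SL).
have [ij|/ltW ji] := leP (look c i) (look (~~ c) j).
  have cF : forall t, S c i <= t -> pos c t = X by apply: cFif; rewrite oW // St.
  by split=> //; apply/oFif/cF/(le_trans SL).
have oF : forall t, S c i <= t -> pos (~~ c) t = X.
  by apply/oFif/(pos_wait ci cX); rewrite ji (le_trans SL).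
by split=> //; apply/cFif/oF.
Qed.

Lemma gathered_chase c i P X L : (i < K)%N -> alive c i -> pos c (S c i) = P ->
  lam c i = 1 -> 0 <= S c i -> parked (~~ c) X (S c i) L ->
  look c i + enorm (X - P) / v c <= L -> gathered pos.
Proof.
move=> iK ci cP l1 S0 park XL.
have St : S c i <= look c i by rewrite lerDl.
have [XP|XP] := eqVneq X P.
  apply: (gathered_arrive ci cP S0); first by rewrite -XP; exact: park.
  apply: le_trans XL; rewrite XP subrr -(scale0r 0) enormZ normr0 !mul0r addr0.
  exact: St.
have z0 : X - P != 0 by rewrite subr_eq0.
have dv : 0 <= enorm (X - P) / v c by rewrite divr_ge0 ?ltW ?enorm_gt0.
have tL : look c i <= L by apply: le_trans XL; rewrite lerDl.
have [|ci1 SE cX _] := move_from iK ci cP _ z0 l1 ler01.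
  by rewrite [P + _]addrC subrK (parked_pos park) // St.
rewrite mul1r in SE; rewrite scale1r [P + _]addrC subrK in cX.
have SS : S c i <= S c i.+1 by rewrite SE (le_trans St) ?lerDl.
apply: (gathered_arrive ci1 cX (le_trans S0 SS) _ (L := L)).
  exact: parkedW park SS (lexx _).
by rewrite SE.
Qed.

(** * The four ways of gathering *)

Lemma gathered_stay r : (0 < K)%N -> lam r 0%N = 1 -> lam (~~ r) 0%N = 0 ->
  W r 0%N + enorm (p0 (~~ r) - p0 r) / v r <= W (~~ r) 0%N + W (~~ r) 1%N ->
  gathered pos.
Proof.
move=> K0 r1 s0 h.
have start q : pos q (S q 0%N) = p0 q.
  by rewrite (follows_start posS) (follows_init posS).
apply: (gathered_chase (X := p0 (~~ r)) (L := W (~~ r) 0%N + W (~~ r) 1%N)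
  K0 (alive0 r) (start r) r1); rewrite ?(follows_start posS) ?add0r //.
rewrite -(follows_start posS (~~ r)); apply: (parked_stay K0 (alive0 _)) => //.
by rewrite (follows_start posS) add0r.
Qed.

(** Positions are coordinates along [w], with [r] starting at 0 and [~~ r] at 1. When [~~ r] first
    looks, [r] has not gone past the end of its move and is at [1 - d], so the displacement seen is
    [- d *: w]. *)
Lemma first_moves r (w : 'rV[R]_2) (l m : R) :
  (0 < K)%N -> p0 (~~ r) = p0 r + w -> w != 0 ->
  W r 0%N <= W (~~ r) 0%N ->
  (W (~~ r) 0%N - W r 0%N) * v r / enorm w < 1 ->
  lam r 0%N = l -> (W (~~ r) 0%N - W r 0%N) * v r / enorm w <= l ->
  lam (~~ r) 0%N = m -> 0 <= m ->
  let d := 1 - (W (~~ r) 0%N - W r 0%N) * v r / enorm w in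
  [/\ alive r 1%N, S r 1%N = W r 0%N + l * enorm w / v r,
      pos r (S r 1%N) = p0 r + l *: w &
      forall t, W r 0%N <= t <= S r 1%N ->
        pos r t = p0 r + ((t - W r 0%N) * v r / enorm w) *: w] /\
  [/\ alive (~~ r) 1%N, S (~~ r) 1%N = W (~~ r) 0%N + m * (d * enorm w) / v (~~ r) &
      pos (~~ r) (S (~~ r) 1%N) = p0 r + (1 - m * d) *: w].
Proof.
move=> K0 sE w0 ab ab1 rl abl sm m0 d.
have ew := enorm_gt0 w0; have vr := v_gt0 r.
have sE1 : p0 (~~ r) = p0 r + 1 *: w by rewrite scale1r.
have start q : pos q (S q 0%N) = p0 q.
  by rewrite (follows_start posS) (follows_init posS).
have look0 q : look q 0%N = W q 0%N by rewrite (follows_start posS) add0r.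
have ab0 : 0 <= (W (~~ r) 0%N - W r 0%N) * v r / enorm w.
  by rewrite divr_ge0 ?mulr_ge0 ?subr_ge0 // ltW.
have l0 : 0 <= l by apply: le_trans abl.
have sW t : 0 <= t <= W (~~ r) 0%N -> pos (~~ r) t = p0 r + w.
  move=> tb; rewrite -sE; apply: (pos_wait (alive0 _) (start _)).
  by rewrite look0 (follows_start posS).
have [|r1 SrE rX rM] := move_from K0 (alive0 r) (start r) _ w0 rl l0.
  by rewrite look0 sW // W_ge0.
rewrite look0 in SrE rM; split; first by split.
have bS : W (~~ r) 0%N <= S r 1%N.
  by rewrite SrE -lerBlDl ler_pdivlMr // -ler_pdivrMr.
have d0 : - d *: w != 0.
  by rewrite scaler_eq0 negb_or w0 andbT oppr_eq0 subr_eq0 eq_sym lt_eqF.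
have [|s1 SsE sX _] := move_from K0 (alive0 (~~ r)) (start _) _ d0 sm m0.
  rewrite negbK look0 rM ?ab // sE1 line_addr.
  by congr (_ + _ *: _); rewrite /d; ring.
split=> //.
  by rewrite SsE look0 enormZ normrN gtr0_norm // subr_gt0.
rewrite sX sE1 scalerA line_addr.
by congr (_ + _ *: _); ring.
Qed.

(** At its second look [~~ r] sees [r] approaching at distance [e * enorm w]. Closing this gap
    head-on takes the time in which [~~ r] covers the fraction [v (~~ r) / (v r + v (~~ r))] of it,
    so [~~ r] arrives just as [r] passes. *)
Lemma gathered_intercept r (w : 'rV[R]_2) :
  (1 < K)%N -> p0 (~~ r) = p0 r + w -> w != 0 ->
  W r 0%N <= W (~~ r) 0%N ->
  (W (~~ r) 0%N + W (~~ r) 1%N - W r 0%N) * v r / enorm w < 1 ->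
  W (~~ r) 2%N = 0 ->
  lam r 0%N = 1 -> lam r 1%N = 1 -> lam (~~ r) 0%N = 0 ->
  lam (~~ r) 1%N = v (~~ r) / (v r + v (~~ r)) -> gathered pos.
Proof.
move=> K1 sE w0 ab b1 W2 lr0 lr1 ls0 ls1.
have K0 : (0 < K)%N by apply: ltnW.
have ew := enorm_gt0 w0; have vr := v_gt0 r; have vs := v_gt0 (~~ r).
have ab1 : (W (~~ r) 0%N - W r 0%N) * v r / enorm w < 1.
  by apply: le_lt_trans b1; rewrite ler_pM2r ?invr_gt0 // ler_pM2r // lerB // lerDl.
have [[r1 SrE rX rM] [s1 SsE sX]] :=
  first_moves K0 sE w0 ab ab1 lr0 (ltW ab1) ls0 (lexx 0).
rewrite !mul0r addr0 in SsE; rewrite mul0r subr0 in sX.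
rewrite mul1r in SrE; rewrite scale1r in rX.
set e := 1 - (W (~~ r) 0%N + W (~~ r) 1%N - W r 0%N) * v r / enorm w.
have e0 : 0 < e by rewrite subr_gt0.
set sg := v (~~ r) / (v r + v (~~ r)) in ls1.
have sg0 : 0 <= sg by rewrite divr_ge0 ?addr_ge0 ?ltW.
have z0 : - e *: w != 0 by rewrite scaler_eq0 negb_or w0 andbT oppr_eq0 gt_eqF.
have WE t : (t - W r 0%N) * v r / enorm w <= 1 -> t <= W r 0%N + enorm w / v r.
  by rewrite ler_pdivrMr // mul1r -ler_pdivlMr // lerBlDl.
have [|s2 S2E s2X _] := move_from K1 s1 sX _ z0 ls1 sg0.
  rewrite negbK SsE rM; last first.
    by rewrite SrE WE ?(ltW b1) // andbT (le_trans ab) // lerDl.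
  by rewrite line_addr; congr (_ + _ *: _); rewrite /e; ring.
rewrite SsE enormZ normrN gtr0_norm // in S2E.
have SW : W r 0%N <= S (~~ r) 2%N.
  rewrite S2E (le_trans ab) // -addrA lerDl addr_ge0 // divr_ge0 ?(ltW vs) //.
  by apply: mulr_ge0 => //; apply: mulr_ge0; exact: ltW.
(* The coordinate of the moving [r] when [~~ r] arrives; it is also that of [~~ r]. *)
have tE : (S (~~ r) 2%N - W r 0%N) * v r / enorm w = 1 - sg * e.
  by rewrite S2E /sg /e; field; rewrite !gt_eqF // addr_gt0.
have SS : S (~~ r) 2%N <= S r 1%N.
  by rewrite SrE WE // tE lerBlDr lerDl mulr_ge0 // ltW.
have sX2 : pos (~~ r) (S (~~ r) 2%N) = p0 r + (1 - sg * e) *: w.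
  by rewrite s2X scalerA line_addr; congr (_ + _ *: _); ring.
have hs : halts (~~ r) 2%N.
  by apply/(haltsE s2).2; rewrite negbK W2 addr0 rM ?SW // tE sX2.
have park L : parked (~~ r) (p0 r + (1 - sg * e) *: w) (S r 1%N) L.
  left=> t St; apply: (pos_halt s2 hs sX2); exact: le_trans St.
apply: (gathered_chase K1 r1 rX lr1 _ (park _) (lexx _)).
by rewrite (le_trans _ SS) // (le_trans _ SW).
Qed.

(** [~~ r] arrives first and stands still for two waits. The robots have not crossed, so [r] still
    has the fraction [1 - l - m * (1 - th)] of [w] to cover. When its travel time is added to the
    delay between the arrivals, [l] cancels; this gives the bound on the waits. *)
Lemma gathered_chase_first r (w : 'rV[R]_2) (l m : R) :
  (1 < K)%N -> p0 (~~ r) = p0 r + w -> w != 0 ->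
  W r 0%N <= W (~~ r) 0%N ->
  let th := (W (~~ r) 0%N - W r 0%N) * v r / enorm w in
  th < 1 -> th <= l -> 0 <= m ->
  lam r 0%N = l -> lam r 1%N = 1 -> lam (~~ r) 0%N = m -> lam (~~ r) 1%N = 0 ->
  m * (1 - th) / v (~~ r) <= (l - th) / v r ->
  l + m * (1 - th) <= 1 ->
  W r 1%N + enorm w * ((1 - m) * (1 - th) / v r - m * (1 - th) / v (~~ r))
    <= W (~~ r) 1%N + W (~~ r) 2%N ->
  gathered pos.
Proof.
move=> K1 sE w0 ab th th1 thl m0 lr0 lr1 ls0 ls1 xy lm hW.
have K0 : (0 < K)%N by apply: ltnW.
have ew := enorm_gt0 w0; have vr := v_gt0 r; have vs := v_gt0 (~~ r).
have [[r1 SrE rX _] [s1 SsE sX]] := first_moves K0 sE w0 ab th1 lr0 thl ls0 m0.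
rewrite -/th in SsE sX.
have thE : W (~~ r) 0%N = W r 0%N + th * enorm w / v r.
  by rewrite /th; field; rewrite !gt_eqF.
have th0 : 0 <= th.
  by rewrite divr_ge0 ?mulr_ge0 ?subr_ge0 // ltW.
have SS : S (~~ r) 1%N <= S r 1%N.
  rewrite SrE SsE thE -subr_ge0.
  rewrite (_ : _ - _ = enorm w * ((l - th) / v r - m * (1 - th) / v (~~ r))).
    by rewrite mulr_ge0 ?(ltW ew) // subr_ge0.
  by field; rewrite !gt_eqF.
have := parked_stay K1 s1 sX ls1 (lexx _).
move=> /parkedW-/(_ _ _ SS (lexx _)) park.
apply: (gathered_chase K1 r1 rX lr1 _ park).
  by rewrite SrE addr_ge0 // divr_ge0 ?mulr_ge0 ?(ltW ew) ?(ltW vr) // (le_trans th0).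
rewrite opprD addrACA subrr add0r -scalerBl enormZ ger0_norm; last by lra.
rewrite -subr_ge0 in hW; rewrite -subr_ge0; apply: (le_trans hW).
rewrite le_eqVlt; apply/orP; left; apply/eqP; rewrite SrE SsE thE.
by field; rewrite !gt_eqF.
Qed.

(** The mirror case: [r] arrives first, [~~ r] chases, and [m] cancels instead of [l]. *)
Lemma gathered_chase_second r (w : 'rV[R]_2) (l m : R) :
  (1 < K)%N -> p0 (~~ r) = p0 r + w -> w != 0 ->
  W r 0%N <= W (~~ r) 0%N ->
  let th := (W (~~ r) 0%N - W r 0%N) * v r / enorm w in
  th < 1 -> th <= l -> 0 <= m ->
  lam r 0%N = l -> lam r 1%N = 0 -> lam (~~ r) 0%N = m -> lam (~~ r) 1%N = 1 ->
  (l - th) / v r <= m * (1 - th) / v (~~ r) ->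
  l + m * (1 - th) <= 1 ->
  W (~~ r) 1%N + enorm w * ((1 - l) / v (~~ r) - (l - th) / v r)
    <= W r 1%N + W r 2%N ->
  gathered pos.
Proof.
move=> K1 sE w0 ab th th1 thl m0 lr0 lr1 ls0 ls1 xy lm hW.
have K0 : (0 < K)%N by apply: ltnW.
have ew := enorm_gt0 w0; have vr := v_gt0 r; have vs := v_gt0 (~~ r).
have [[r1 SrE rX _] [s1 SsE sX]] := first_moves K0 sE w0 ab th1 lr0 thl ls0 m0.
rewrite -/th in SsE sX.
have thE : W (~~ r) 0%N = W r 0%N + th * enorm w / v r.
  by rewrite /th; field; rewrite !gt_eqF.
have SS : S r 1%N <= S (~~ r) 1%N.
  rewrite SrE SsE thE -subr_ge0.
  rewrite (_ : _ - _ = enorm w * (m * (1 - th) / v (~~ r) - (l - th) / v r)).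
    by rewrite mulr_ge0 ?(ltW ew) // subr_ge0.
  by field; rewrite !gt_eqF.
have := parked_stay K1 r1 rX lr1 (lexx _).
move=> /parkedW-/(_ _ _ SS (lexx _)); rewrite -[X in parked X]negbK => park.
apply: (gathered_chase K1 s1 sX ls1 _ park).
  rewrite SsE addr_ge0 // divr_ge0 ?(ltW vs) // !mulr_ge0 ?(ltW ew) //.
  by rewrite subr_ge0 ltW.
rewrite opprD addrACA subrr add0r -scalerBl enormZ ler0_norm; last by lra.
rewrite -subr_ge0 in hW; rewrite -subr_ge0; apply: (le_trans hW).
rewrite le_eqVlt; apply/orP; left; apply/eqP; rewrite SrE SsE thE.
by field; rewrite !gt_eqF.
Qed.

End Kinematics.

(** * Rational fractions close to a head-on meeting *)

(* With the fractions [vr / (vr + vs)] and [vs / (vr + vs)] of the distance the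
   robots would meet exactly; the first looker has covered the fraction [th] of
   it when the second one looks. *)
Lemma near_meeting_first (R : realType) (vr vs th d eps : R) :
  0 < vr -> 0 < vs -> th < 1 -> 0 < d -> 0 < eps ->
  exists ql qm : rat, let l := ratr ql in let m := ratr qm in
    [/\ th <= l, 0 <= m, m * (1 - th) / vs <= (l - th) / vr,
        l + m * (1 - th) <= 1 &
        d * ((1 - m) * (1 - th) / vr - m * (1 - th) / vs) <= eps].
Proof.
move=> vr0 vs0 th1 d0 eps0.
have th0 : 0 < 1 - th by rewrite subr_gt0.
have vv0 : 0 < vr + vs by rewrite addr_gt0.
set sg := vs / (vr + vs).
have sg0 : 0 < sg by rewrite divr_gt0.
(* The time to be made small is [C * (sg - m)], so [m] is taken less than [eps / C] below [sg]. *)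
set C := d * (1 - th) * (vr^-1 + vs^-1).
have iv0 : 0 < vr^-1 + vs^-1 by rewrite addr_gt0 ?invr_gt0.
have C0 : 0 < C by rewrite !mulr_gt0.
have lo_lt : Num.max 0 (sg - eps / C) < sg.
  by rewrite gt_max sg0 ltrBlDr ltrDl divr_gt0.
have [qm] := rat_in_itvoo lo_lt.
rewrite in_itv /= gt_max => /andP[/andP[m0 mC] msg].
set m : R := ratr qm in m0 mC msg *.
(* The lower bound makes [r] arrive last, the upper one prevents crossing. They coincide for
   [m = sg]; [m < sg] leaves room for a rational [l]. *)
have l_lt : th + m * (1 - th) * vr / vs < 1 - m * (1 - th).
  rewrite -subr_gt0.
  have -> : 1 - m * (1 - th) - (th + m * (1 - th) * vr / vs) =
            (1 - th) * ((sg - m) * (vr + vs) / vs).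
    by rewrite /sg; field; rewrite !gt_eqF.
  by rewrite mulr_gt0 // divr_gt0 // mulr_gt0 // subr_gt0.
have [ql] := rat_in_itvoo l_lt; rewrite in_itv /= => /andP[l1 l2].
exists ql, qm; split; [|exact: ltW| | |].
- apply: le_trans (ltW l1); rewrite lerDl.
  by apply/ltW; rewrite divr_gt0 // mulr_gt0 // mulr_gt0.
- rewrite ler_pdivlMr // mulrAC lerBrDl; exact: ltW.
- by rewrite -lerBrDr ltW.
- have -> : d * ((1 - m) * (1 - th) / vr - m * (1 - th) / vs) = C * (sg - m).
    by rewrite /C /sg; field; rewrite !gt_eqF.
  by rewrite -ler_pdivlMl // mulrC lerBlDr -lerBlDl ltW.
Qed.

(** Here [m] can be exact, as the head-on fraction is itself available to the robots; only [l],
    whose ideal value [L] depends on [th], is approximated from below. *)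
Lemma near_meeting_second (R : realType) (vr vs th d eps : R) :
  0 < vr -> 0 < vs -> th < 1 -> 0 < d -> 0 < eps ->
  exists ql : rat, let l := ratr ql in let m := vs / (vr + vs) in
    [/\ th <= l, (l - th) / vr <= m * (1 - th) / vs, l + m * (1 - th) <= 1 &
        d * ((1 - l) / vs - (l - th) / vr) <= eps].
Proof.
move=> vr0 vs0 th1 d0 eps0.
have th0 : 0 < 1 - th by rewrite subr_gt0.
have vv0 : 0 < vr + vs by rewrite addr_gt0.
set sg := vs / (vr + vs).
set L := th + (1 - th) * vr / (vr + vs).
set C := d * (vr^-1 + vs^-1).
have iv0 : 0 < vr^-1 + vs^-1 by rewrite addr_gt0 ?invr_gt0.
have C0 : 0 < C by rewrite !mulr_gt0.
have lo_lt : Num.max th (L - eps / C) < L.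
  by rewrite gt_max ltrBlDr !ltrDl !divr_gt0 // mulr_gt0.
have [ql] := rat_in_itvoo lo_lt.
rewrite in_itv /= gt_max => /andP[/andP[l0 lC] lL].
set l : R := ratr ql in l0 lC lL *.
exists ql; split; first exact: ltW.
- rewrite ler_pdivrMr // lerBlDl (le_trans (ltW lL)) // le_eqVlt.
  by apply/orP; left; apply/eqP; rewrite /L /sg; field; rewrite !gt_eqF.
- rewrite -lerBrDr (le_trans (ltW lL)) // le_eqVlt.
  by apply/orP; left; apply/eqP; rewrite /L /sg; field; rewrite !gt_eqF.
- have -> : d * ((1 - l) / vs - (l - th) / vr) = C * (L - l).
    by rewrite /C /L; field; rewrite !gt_eqF.
  by rewrite -ler_pdivlMl // mulrC lerBlDr -lerBlDl ltW.
Qed.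

(** * Choice of fractions for given waits *)

(** A countable set that does not depend on the waits, and symmetric in the two robots since neither
    knows which speed it has. *)
Definition usable (R : realType) (v : bool -> R) (x : R) : Prop :=
  (exists q : rat, x = ratr q) \/ exists r, x = v r / (v r + v (~~ r)).

Definition strategy (R : realType) (r : bool) (x0 x1 y0 y1 : R)
    (q : bool) (k : nat) : R :=
  if q == r then if k == 0%N then x0 else x1 else if k == 0%N then y0 else y1.

Lemma strategyE (R : realType) (r : bool) (x0 x1 y0 y1 : R) :
  [/\ strategy r x0 x1 y0 y1 r 0%N = x0, strategy r x0 x1 y0 y1 r 1%N = x1,
      strategy r x0 x1 y0 y1 (~~ r) 0%N = y0 &
      strategy r x0 x1 y0 y1 (~~ r) 1%N = y1].
Proof. by case: r. Qed.

Lemma usable_strategy (R : realType) (v : bool -> R) (r : bool)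
    (x0 x1 y0 y1 : R) :
  usable v x0 -> usable v x1 -> usable v y0 -> usable v y1 ->
  forall q k, usable v (strategy r x0 x1 y0 y1 q k).
Proof. by move=> *; rewrite /strategy; do !case: ifP. Qed.

(** The cases are decided by speeds, waits and initial positions alone, so [lam] is fixed before the
    execution. *)
Lemma exists_strategy (R : realType) (v : bool -> R) (W : bool -> nat -> R)
    (p0 : bool -> 'rV[R]_2) :
  (forall r, 0 < v r) -> (forall r k, 0 <= W r k) ->
  exists lam : bool -> nat -> R, (forall r k, usable v (lam r k)) /\
    forall pos S, follows v W lam 2 p0 pos S -> gathered pos.
Proof.
move=> v0 W0.
have uQ q : usable v (ratr q) by left; exists q.
have u0 : usable v 0 by left; exists 0; rewrite rmorph0.
have u1 : usable v 1 by left; exists 1; rewrite rmorph1.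
have um r : usable v (v (~~ r) / (v r + v (~~ r))).
  by right; exists (~~ r); rewrite negbK addrC.
have [r ab] : exists r, W r 0%N <= W (~~ r) 0%N.
  by have [?|/ltW ?] := leP (W true 0%N) (W false 0%N); [exists true|exists false].
set w := p0 (~~ r) - p0 r.
have sE : p0 (~~ r) = p0 r + w by rewrite addrC subrK.
have vr := v0 r; have vs := v0 (~~ r).
have [near|far] := leP (W r 0%N + enorm w / v r) (W (~~ r) 0%N + W (~~ r) 1%N).
  exists (strategy r 1 0 0 0); split; first exact: usable_strategy.
  have [x0E x1E y0E y1E] := strategyE r 1 0 0 (0 : R).
  by move=> pos S /gathered_stay H; apply: (H v0 W0 r).
have w0 : w != 0.
  apply: contraTneq far => ->; rewrite -(scale0r 0) enormZ normr0 !mul0r addr0.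
  by rewrite -leNgt (le_trans ab) // lerDl.
have ew := enorm_gt0 w0.
have b1 : (W (~~ r) 0%N + W (~~ r) 1%N - W r 0%N) * v r / enorm w < 1.
  by rewrite ltr_pdivrMr // mul1r -ltr_pdivlMr // ltrBlDl.
set th := (W (~~ r) 0%N - W r 0%N) * v r / enorm w.
have th1 : th < 1.
  by apply: le_lt_trans b1; rewrite ler_pM2r ?invr_gt0 // ler_pM2r // lerB // lerDl.
have [W2|W2] := eqVneq (W (~~ r) 2%N) 0.
  exists (strategy r 1 1 0 (v (~~ r) / (v r + v (~~ r)))).
  split; first exact: usable_strategy.
  have [x0E x1E y0E y1E] := strategyE r 1 1 0 (v (~~ r) / (v r + v (~~ r))).
  by move=> pos S /gathered_intercept H; apply: (H v0 W0 r w).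
have W2_gt0 : 0 < W (~~ r) 2%N by rewrite lt_neqAle eq_sym W2 W0.
have [c1|c2] := ltP (W r 1%N) (W (~~ r) 1%N + W (~~ r) 2%N).
  rewrite -subr_gt0 in c1.
  have [ql [qm [thl m0 xy lm hW]]] := near_meeting_first vr vs th1 ew c1.
  exists (strategy r (ratr ql) 1 (ratr qm) 0); split; first exact: usable_strategy.
  have [x0E x1E y0E y1E] := strategyE r (ratr ql) 1 (ratr qm) (0 : R).
  move=> pos S /gathered_chase_first H.
  apply: (H v0 W0 r w (ratr ql) (ratr qm)) => //.
  by rewrite -lerBrDl.
(* By [c2], [W r 1%N] is at least [W (~~ r) 1%N] plus the positive [W (~~ r) 2%N]. *)
have c1 : W (~~ r) 1%N < W r 1%N + W r 2%N.
  by have := W0 r 2%N; lra.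
rewrite -subr_gt0 in c1.
have [ql [thl xy lm hW]] := near_meeting_second vr vs th1 ew c1.
have := um r; set m := v (~~ r) / (v r + v (~~ r)) => m_usable.
exists (strategy r (ratr ql) 0 m 1); split; first exact: usable_strategy.
have [x0E x1E y0E y1E] := strategyE r (ratr ql) 0 m 1.
move=> pos S /gathered_chase_second H.
apply: (H v0 W0 r w (ratr ql) m) => //; last by rewrite -lerBrDl.
by apply/ltW; rewrite divr_gt0 ?addr_gt0.
Qed.

(** * The algorithm *)

Definition fraction (R : realType) (alpha : R) (n : nat) : R :=
  match unpickle n : option (rat + bool)%type with
  | Some (inl q) => ratr q
  | Some (inr b) => (if b then alpha else 1) / (1 + alpha)
  | None => 0
  end.

(** A head-on fraction is homogeneous in the speeds, hence determined by [alpha] and by which speed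
    is [alpha] times the other. *)
Lemma usable_fraction (R : realType) (alpha : R) (v : bool -> R) (x : R) :
  (forall r, 0 < v r) ->
  v true = alpha * v false \/ v false = alpha * v true ->
  0 < alpha -> usable v x -> exists n, fraction alpha n = x.
Proof.
move=> v0 av a0 [[q ->]|[r ->]].
  by exists (pickle (inl q : rat + bool)%type); rewrite /fraction pickleK.
have a1 : 0 < 1 + alpha by rewrite addr_gt0.
have [b ->] : exists b : bool,
    v r / (v r + v (~~ r)) = (if b then alpha else 1) / (1 + alpha).
  by case: av => vE; case: r; rewrite /= vE;
    [exists true|exists false|exists false|exists true];
    field; rewrite !gt_eqF ?addr_gt0 ?mulr_gt0.
by exists (pickle (inr b : rat + bool)%type); rewrite /fraction pickleK.
Qed.

Theorem theorem2 (R : realType) (alpha : R) (halpha : 0 < alpha) :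
  exists A : algorithm R,
  forall (v : bool -> R) (F : bool -> 'rV[R]_2 -> 'rV[R]_2)
         (p0 : bool -> 'rV[R]_2) (W : bool -> nat -> R),
    (forall r, 0 < v r) ->
    (v true = alpha * v false \/ v false = alpha * v true) ->
    (forall r, is_similarity (F r)) ->
    (forall r k, 0 <= W r k) ->
    exists E : set R,
      measurable E /\ E `<=` `[0, 1] /\ (0 < lebesgue_measure E)%E /\
      forall w, E w ->
        forall (pos : bool -> R -> 'rV[R]_2) (S : bool -> nat -> R),
          execution A v F W (coins w) p0 pos S -> gathered pos.
Proof.
(* A similarity commutes with scaling, so this destination does not depend on the local frame. *)
exists (fun u c => fraction alpha (first_tail c) *: u) => v F p0 W v0 av simF W0.
have [lam [lamP gath]] := exists_strategy p0 v0 W0.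
have [e eP] := choice (fun x : bool * nat =>
  usable_fraction v0 av halpha (lamP x.1 x.2)).
(* Only the first two cycles of each robot are prescribed, through the codes [e] of their
   fractions. *)
have [E [mE [E01 [E0 EP]]]] := prescribed_coins R (fun r k => e (r, k)) 2.
exists E; split=> //; split=> //; split=> // w wE pos S ex.
apply: (gath pos S); split.
- by move=> r; have [] := ex r.
- by move=> r; have [_ []] := ex r.
- by move=> r k rk; have [_ [_ /(_ k rk)[]]] := ex r.
- by move=> r k rk hk; have [_ [_ /(_ k rk)[_ [/(_ hk)]]]] := ex r.
move=> r k k2 rk nh; have [_ [_ /(_ k rk)[_ [_ /(_ nh)[u [uE]]]]]] := ex r.
rewrite /= similarityZ // uE EP // eP /=.
by rewrite [pos r _ + _]addrC addrK.
Qed.
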